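(* Let $n\geq 12$ be an even integer. Among all binary trees on $n$ vertices, the distance between center and centroid is maximized by a crg tree; that is, there is a crg tree $T^*$ on $n$ vertices such that $d_T(C(T),C_d(T))\leq d_{T^*}(C(T^* ),C_d(T^* ))$ for every binary tree $T$ on $n$ vertices.
   Context: All graphs are finite, simple, connected and undirected. A pendant vertex is a vertex of degree $1$. A binary tree is a tree in which every non-pendant vertex has degree $3$ (so its number of vertices is even). Center and centroid: the eccentricity of $v\in V(T)$ is $e(v)=\max_{u}d_T(u,v)$; the center $C(T)$ is the set of vertices of minimum eccentricity. A branch at $v$ is a maximal subtree of $T$ containing $v$ as a pendant vertex; the weight of $v$ is the maximum number of edges in a branch at $v$; the centroid $C_d(T)$ is the set of vertices of minimum weight. For $X,Y\subseteq V(T)$, $d_T(X,Y)=\min\{d_T(x,y):x\in X,y\in Y\}$. Rooted binary trees: a rooted binary tree is a rooted tree whose root has degree $2$ and in which every other vertex has degree $1$ or $3$; the single-vertex rooted tree is also allowed. The height (level) of a vertex is its distance to the root. A rooted binary tree is ordered if the vertices of each level $l\ge 1$ are linearly ordered so that two vertices at level $l+1$ with different parents are ordered as their parents are at level $l$. A rooted binary tree is rgood if (i) the heights of any two of its pendant vertices differ by at most $1$, and (ii) it can be ordered so that the parents of the pendant vertices at the highest level form a final segment in the ordering of the vertices at the next-to-highest level. For each odd $l$ there is, up to isomorphism, exactly one rgood binary tree on $l$ vertices, denoted $T_{rg}^l$. Crg trees: a binary caterpillar is a binary tree having a path such that every vertex not on the path is adjacent to a vertex of the path. For even $n\ge 4$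 and odd $l$ with $3\le l<n$, the crg tree $T_{rg}^{n,l}$ is the tree on $n$ vertices obtained by identifying the root of $T_{rg}^l$ with a vertex of maximum eccentricity of a binary caterpillar on $n-l+1$ vertices. *)

(* Defs.v *)
From mathcomp Require Import all_boot.

Set Implicit Arguments.
Unset Strict Implicit.
Unset Printing Implicit Defensive.

Record sgraph := SGraph {
  vertex :> finType;
  adj : rel vertex;
  adj_sym : symmetric adj;
  adj_irr : irreflexive adj }.

Definition giso (G H : sgraph) : Prop :=
  exists2 f : G -> H, bijective f & {mono f : x y / adj x y}.

Section Graphs.
Variable G : sgraph.
Implicit Types (u v x y : G) (A X Y : {set G}).

Definition deg v : nat := #|[set u | adj v u]|.

Definition pendant v : bool := deg v == 1.

Definition edges : {set {set G}} :=
  [set E : {set G} | [exists x, exists y, adj x y && (E == [set x; y])]].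

Definition connected : bool :=
  (0 < #|G|) && [forall x, forall y, connect (@adj G) x y].

(* A cycle has at least 3 vertices, and at most #|G| as they are distinct;
   the bound only serves to keep the predicate boolean. *)
Definition acyclic : bool :=
  [forall k : 'I_#|G|.+1, (2 < k) ==>
     [forall c : k.-tuple G, ~~ ucycleb (@adj G) c]].

Definition tree : bool := connected && acyclic.

Definition binary_tree : bool :=
  tree && [forall v, ~~ pendant v ==> (deg v == 3)].

Definition walk (k : nat) x y : bool :=
  [exists p : k.-tuple G, path (@adj G) x p && (last x p == y)].

(* The default value #|G| is only taken when x and y are not connected: in a
   connected graph all distances are smaller than #|G|. *)
Definition dist x y : nat := \big[minn/#|G|]_(k < #|G| | walk k x y) k.

Definition dist_set X Y : nat :=
  \big[minn/#|G|]_(x in X) \big[minn/#|G|]_(y in Y) dist x y.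

Definition ecc v : nat := \max_u dist v u.

Definition center : {set G} := [set v | [forall u, ecc v <= ecc u]].

Lemma induced_sym A : symmetric (relpre (val : {x | x \in A} -> G) (@adj G)).
Proof. by move=> x y; apply: adj_sym. Qed.

Lemma induced_irr A : irreflexive (relpre (val : {x | x \in A} -> G) (@adj G)).
Proof. by move=> x; apply: adj_irr. Qed.

Definition induced A : sgraph := SGraph (@induced_sym A) (@induced_irr A).

End Graphs.

Section Centroid.
Variable G : sgraph.
Implicit Types (v : G) (A : {set G}).

(* Subtrees are given by their vertex sets: in a tree, every subtree is the
   subgraph induced by its vertices. *)
Definition subtree_pendant v A : bool :=
  tree (induced A) && [exists x : induced A, (val x == v) && pendant x].

Definition branch v A : bool := maxset (subtree_pendant v) A.

Definition weight v : nat := \max_(A | branch v A) #|edges (induced A)|.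

Definition centroid : {set G} := [set v | [forall u, weight v <= weight u]].

Definition center_centroid_dist : nat := dist_set (center G) centroid.

End Centroid.

Section Rooted.
Variables (G : sgraph) (r : G).
Implicit Types (h : nat) (x y : G) (le : rel G).

Definition rooted_binary_tree : bool :=
  tree G && ((#|G| == 1) ||
    (deg r == 2) && [forall v, (v != r) ==> (deg v \in [:: 1; 3])]).

Definition level h : {set G} := [set x | dist r x == h].

Definition parent x y : bool := adj x y && (dist r y == (dist r x).+1).

Definition linear_on (A : {set G}) le : Prop :=
  [/\ {in A &, total le}, {in A &, antisymmetric le}
    & {in A & &, transitive le}].

(* le is only meaningful between vertices of the same level. *)
Definition tree_ordering le : Prop :=
  (forall h, 0 < h -> linear_on (level h) le) /\
  (forall h x y x' y', 0 < h -> x \in level h.+1 -> y \in level h.+1 ->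
     parent x' x -> parent y' y -> x' != y' -> le x y = le x' y').

Definition top_level : nat := \max_x dist r x.

Definition top_parents : {set G} :=
  [set x | [exists y in level top_level, pendant y && parent x y]].

Definition final_segment le (A S : {set G}) : Prop :=
  S \subset A /\ {in S & A, forall x y, le x y -> y \in S}.

Definition rgood : Prop :=
  [/\ rooted_binary_tree,
      forall x y, pendant x -> pendant y -> dist r x <= (dist r y).+1
    & exists2 le, tree_ordering le
        & final_segment le (level top_level.-1) top_parents].

End Rooted.

Definition binary_caterpillar (G : sgraph) : Prop :=
  binary_tree G /\
  exists (x : G) (p : seq G),
    [/\ path (@adj G) x p, uniq (x :: p)
      & forall v, v \notin x :: p -> exists2 u, u \in x :: p & adj v u].

Definition max_ecc (G : sgraph) (v : G) : Prop := forall u : G, ecc u <= ecc v.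

(* Identification of the vertex k of K with the vertex r of R: the merged
   vertex is represented by inl k. *)
Section Glue.
Variables (K : sgraph) (k : K) (R : sgraph) (r : R).

Definition glue_adj (a b : K + {x : R | x != r}) : bool :=
  match a, b with
  | inl x, inl y => adj x y
  | inl x, inr y => (x == k) && adj r (val y)
  | inr x, inl y => (y == k) && adj r (val x)
  | inr x, inr y => adj (val x) (val y)
  end.

Lemma glue_sym : symmetric glue_adj.
Proof. by case=> x [] y //=; apply: adj_sym. Qed.

Lemma glue_irr : irreflexive glue_adj.
Proof. by case=> x /=; apply: adj_irr. Qed.

Definition glue : sgraph := SGraph glue_sym glue_irr.

End Glue.

Definition crg_tree_nl (n l : nat) (G : sgraph) : Prop :=
  exists (R : sgraph) (r : R) (K : sgraph) (k : K),
    [/\ rgood r /\ #|R| = l,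
        binary_caterpillar K /\ #|K| = n - l + 1,
        max_ecc k
      & giso G (glue k r)].

Definition crg_tree (n : nat) (G : sgraph) : Prop :=
  [/\ ~~ odd n, 4 <= n
    & exists l, [/\ odd l, 3 <= l < n & crg_tree_nl n l G]].

(* Main.v *)
Require Import Defs.
From mathcomp Require Import all_boot zify.

(* Let d > 0 be the distance between centre and centroid of T, attained at the
   centre vertex z and the centroid vertex w, and let u be the neighbour of w
   towards z.  Removing the edge uw leaves a component of m < n/2 vertices around
   u (by minimality of the weight of w) and one of n - m vertices around w, of
   height h say.  Since z is in the centre, some vertex lies beyond z, at distance
   at least d + h from it, hence at distance at least 2d - 1 + h from u in the
   component of u; the latter has therefore at least 1 + 2(2d - 1 + h) vertices,
   so 4d + 2h <= m + 1, whereas n - m < 2^(h+1).  With q = n/4 (rounded down) and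
   m replaced by the largest odd number 2q - 1 below n/2, equality up to rounding
   is reached by gluing the root of the rgood tree on n - 2q + 1 vertices to an
   end of the binary caterpillar on 2q vertices. *)

Set Implicit Arguments.
Unset Strict Implicit.
Unset Printing Implicit Defensive.

(** The start value [N] takes part in the minimum, hence the first conjunct. The default values of
    [dist] and [dist_set] are handled through this lemma. *)
Lemma leq_bigminn (I : finType) (P : pred I) (F : I -> nat) (m N : nat) :
  reflect (m <= N /\ forall i, P i -> m <= F i)
    (m <= \big[minn/N]_(i | P i) F i).
Proof.
apply: (iffP idP) => [mb | [mN mF]].
  suff [bN bF]: \big[minn/N]_(i | P i) F i <= N /\
      forall i, P i -> \big[minn/N]_(i | P i) F i <= F i.
    split=> [|i /bF]; first exact: leq_trans bN.
    exact: leq_trans.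
  split; first by elim/big_rec: _ => // i x _ xN; rewrite geq_min xN orbT.
  move=> i Pi; have: i \in index_enum I by rewrite mem_index_enum.
  elim: (index_enum I) => //= j r IHr; rewrite inE big_cons.
  case/predU1P=> [<- | /IHr le_r]; first by rewrite Pi geq_minl.
  by case: (P j); rewrite // geq_min le_r orbT.
by elim/big_rec: _ => // i x Pi mx; rewrite leq_min mx mF.
Qed.

(** * Distances in connected graphs *)

Section Distance.
Variable G : sgraph.
Implicit Types (r u v w x y z : G) (p : seq G).

Lemma connect_adj_sym : connect_sym (@adj G).
Proof. by apply: sym_connect_sym => x y; rewrite adj_sym. Qed.

Lemma walkP k x y :
  reflect (exists p, [/\ path (@adj G) x p, last x p = y & size p = k])
    (walk k x y).
Proof.
apply: (iffP existsP) => [[p /andP[xp /eqP lp]] | [p [xp lp sp]]].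
  by exists p; rewrite size_tuple.
have sz_p : size p == k by apply/eqP.
by exists (Tuple sz_p); rewrite xp lp eqxx.
Qed.

Lemma leq_distP m x y :
  reflect (m <= #|G| /\ forall k, k < #|G| -> walk k x y -> m <= k)
    (m <= dist x y).
Proof.
apply: (iffP (leq_bigminn _ _ _ _)) => -[mG mk]; split=> //.
  by move=> k kG; apply: (mk (Ordinal kG)).
by move=> k; apply: mk.
Qed.


Lemma dist_le_path x p : path (@adj G) x p -> dist x (last x p) <= size p.
Proof.
move=> xp; have [dG dk] := leq_distP _ _ _ (leqnn (dist x (last x p))).
(* A path with at least [#|G|] edges does not enter the minimum, but is then no shorter than the
   default value. *)
have [pG | /(leq_trans dG)//] := ltnP (size p) #|G|.
by apply: dk => //; apply/walkP; exists p.
Qed.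

Lemma distxx x : dist x x = 0.
Proof. by apply/eqP; rewrite -leqn0 (@dist_le_path x [::]). Qed.

(** Stepping repeatedly to a neighbour of smaller [g] leads from [v] to [z] in at most [g v] steps.
    Upper bounds on distances in the constructed trees come from here. *)
Lemma dist_descent (g : G -> nat) z :
    (forall v, v != z -> exists2 u, adj u v & g u < g v) ->
  forall v, dist z v <= g v.
Proof.
move=> gP v.
suff [p [zp <- sp]]: exists p, [/\ path (@adj G) z p, last z p = v & size p <= g v].
  by apply: leq_trans sp; apply: dist_le_path.
have [n] := ubnP (g v); elim: n v => // n IHn v; rewrite ltnS => gv.
have [-> | /gP[u uv gu]] := eqVneq v z; first by exists [::].
have [p [zp lp sp]] := IHn u (leq_trans gu gv).
exists (rcons p v); rewrite rcons_path last_rcons size_rcons zp lp uv.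
by split=> //; apply: leq_ltn_trans gu.
Qed.

Hypothesis Gconn : connected G.

Lemma connectedT x y : connect (@adj G) x y.
Proof. by have /andP[_ /forallP/(_ x)/forallP/(_ y)] := Gconn. Qed.

Lemma dist_path x y :
  exists p, [/\ path (@adj G) x p, last x p = y & size p = dist x y].
Proof.
(* A path without repeated vertices has fewer than [#|G|] edges, so the default value of [dist] is
   not reached. *)
have [k0 k0G wk0] : exists2 k, k < #|G| & walk k x y.
  have /connectP[p xp ->] := connectedT x y.
  case/shortenP: xp => p' xp' Up' _; exists (size p').
    by have /card_uniqP /= <- := Up'; apply: max_card.
  by apply/walkP; exists p'.
have exw : exists k, walk k x y by exists k0.
case: (ex_minnP exw) => k /walkP[p [xp lp sp]] k_min.
exists p; split=> //; apply/eqP; rewrite eqn_leq -{2}lp dist_le_path // andbT sp.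
apply/leq_distP; split; first exact: leq_trans (k_min _ wk0) (ltnW k0G).
by move=> i _ /k_min.
Qed.

(** The counterpart of [dist_descent]: a function growing by at most one per edge bounds distances
    from below. *)
Lemma dist_lipschitz (f : G -> nat) :
    (forall x y, adj x y -> f y <= (f x).+1) ->
  forall x y, f y <= f x + dist x y.
Proof.
move=> fP x y; have [p [xp <- <-]] := dist_path x y.
elim: p x xp => [|z p IHp] x /=; first by rewrite addn0.
case/andP=> /fP fz /IHp; lia.
Qed.

Lemma dist_sym x y : dist x y = dist y x.
Proof.
suff le_d u v : dist u v <= dist v u by apply/eqP; rewrite eqn_leq !le_d.
have [p [vp <- <-]] := dist_path v u.
have := @dist_le_path (last v p) (rev (belast v p)).
rewrite size_rev size_belast rev_path (eq_path (e' := @adj G)) => [|? ?]; last first.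
  by rewrite adj_sym.
move/(_ vp); congr (dist _ _ <= _).
by case: p {vp} => //= a p; rewrite rev_cons last_rcons.
Qed.

Lemma dist_triangle x y z : dist x z <= dist x y + dist y z.
Proof.
have [p [xp <- <-]] := dist_path x y; have [q [yq <- <-]] := dist_path (last x p) z.
by rewrite -size_cat -last_cat dist_le_path // cat_path xp.
Qed.

Lemma dist_adj x y : adj x y -> dist x y <= 1.
Proof. by move=> xy; apply: (@dist_le_path x [:: y]); rewrite /= xy. Qed.

Lemma dist_adj_step r x y : adj x y -> dist r y <= (dist r x).+1.
Proof.
by move=> /dist_adj xy; rewrite -addn1 (leq_trans (dist_triangle r x y)) ?leq_add2l.
Qed.

Lemma dist_eq0 x y : (dist x y == 0) = (x == y).
Proof.
apply/eqP/eqP=> [d0 | ->]; last exact: distxx.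
by have [[|a p] [_ + sp]] := dist_path x y; first by []; rewrite -sp in d0.
Qed.

Lemma dist_pred r x : x != r -> exists2 y, adj x y & dist r x = (dist r y).+1.
Proof.
have [p [+ + +]] := dist_path r x; case/lastP: p => [_ /= -> | p y]; first by rewrite eqxx.
rewrite rcons_path last_rcons size_rcons => /andP[rp yx] yE dE _; rewrite -{}yE in dE *.
exists (last r p); first by rewrite adj_sym.
apply/eqP; rewrite eqn_leq dist_adj_step //= -dE ltnS.
exact: dist_le_path.
Qed.

End Distance.

(** * Rank functions as criteria for connectedness and acyclicity *)

Lemma connected_descent (G : sgraph) (r : G) (g : G -> nat) :
  (forall x, x != r -> exists2 y, adj x y & g y < g x) -> connected G.
Proof.
move=> gP; have toR x : connect (@adj G) x r.
  have [n] := ubnP (g x); elim: n x => // n IHn x; rewrite ltnS => gx.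
  have [-> | /gP[y xy gy]] := eqVneq x r; first exact: connect0.
  exact: connect_trans (connect1 xy) (IHn y (leq_trans gy gx)).
apply/andP; split; first by apply/card_gt0P; exists r.
apply/forallP=> x; apply/forallP=> y; apply: connect_trans (toR x) _.
by rewrite connect_adj_sym.
Qed.

(* A vertex of a cycle at which [g] is maximal would have two such neighbours. *)
Lemma acyclic_rank (G : sgraph) (g : G -> nat) :
    (forall x y z, adj x y -> adj x z -> g y <= g x -> g z <= g x -> y = z) ->
  acyclic G.
Proof.
move=> gP; apply/forallP=> k; apply/implyP=> k_gt2; apply/forallP=> c.
apply/negP=> /andP[cyc Uc].
have k_gt0 : 0 < k by apply: leq_trans k_gt2.
case: (@arg_maxnP _ (tnth c (Ordinal k_gt0)) (mem c) g (mem_tnth _ _)) => x xc x_max.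
have [i s def_s] := rot_to xc.
have s_sub y : y \in x :: s -> g y <= g x.
  by rewrite -def_s mem_rot; apply: x_max.
have := size_rot i c; rewrite def_s size_tuple => sz.
rewrite -(rot_cycle i) def_s in cyc; rewrite -(rot_uniq i) def_s in Uc.
case: s cyc Uc s_sub sz {def_s} => [|y [|z s]] /=.
- by move=> _ _ _ k1; rewrite -k1 in k_gt2.
- by move=> _ _ _ k2; rewrite -k2 in k_gt2.
rewrite rcons_path => /and3P[xy _ /andP[_ zx]] /and3P[_ y_notin _] s_sub _.
have lz: last z s \in z :: s by exact: mem_last.
case/negP: y_notin; rewrite (gP x y (last z s)) //; first by rewrite adj_sym.
  by apply: s_sub; rewrite !inE eqxx orbT.
by apply: s_sub; rewrite 2!in_cons lz !orbT.
Qed.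

(** * Parents and edges in trees *)

Section Tree.
Variable G : sgraph.
Implicit Types (r s u v w x y z : G).
Hypothesis Gtree : tree G.

Lemma tree_connected : connected G. Proof. by case/andP: Gtree. Qed.
Let Gconn := tree_connected.

Lemma tree_no_ucycle c : cycle (@adj G) c -> uniq c -> size c <= 2.
Proof.
move=> cyc Uc; rewrite leqNgt; apply/negP => c_gt2.
have szc : size c < #|G|.+1 by have /card_uniqP <- := Uc; rewrite ltnS max_card.
have /andP[_ /forallP/(_ (Ordinal szc))/implyP/(_ c_gt2)/forallP] := Gtree.
by move/(_ (in_tuple c)); rewrite /ucycleb /= cyc Uc.
Qed.

(* Otherwise shortest paths from [y] and [z] to [r], which avoid [x], close up to
   a cycle through [x]. *)
Lemma tree_parent_uniq r x y z :
    adj x y -> adj x z -> dist r y <= dist r x -> dist r z <= dist r x ->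
  y = z.
Proof.
move=> xy xz ry rz; apply/eqP/negPn/negP => yz.
pose e := [rel a b : G | [&& adj a b, a != x & b != x]].
have e_sym : connect_sym e.
  by apply: sym_connect_sym => a b; rewrite /= adj_sym; congr (_ && _); rewrite andbC.
have conn_r v : v != x -> dist r v <= dist r x -> connect e r v.
  have [n] := ubnP (dist r v); elim: n v => // n IHn v; rewrite ltnS => vn vx vr.
  have [-> | /(dist_pred Gconn)[u vu ru]] := eqVneq v r; first by rewrite connect0.
  have ux : u != x by apply: contraTneq vr => <-; rewrite -ltnNge ru.
  have ltur : dist r u < dist r v by rewrite ru.
  apply: connect_trans (IHn u (leq_trans ltur vn) ux (ltnW (leq_trans ltur vr))) _.
  by apply: connect1; rewrite /= adj_sym vu ux.
have adj_neq v : adj x v -> v != x by apply: contraTneq => ->; rewrite adj_irr.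
have : connect e y z.
  apply: connect_trans (conn_r z (adj_neq z xz) rz).
  by rewrite e_sym conn_r // adj_neq.
case/connectP=> p0 /shortenP[p yp Up _] def_z.
have x_notin : x \notin y :: p.
  have avoid a q : path e a q -> x \notin q.
    elim: q a => //= b q IHq a /andP[/and3P[_ _ bx] /IHq xq].
    by rewrite inE negb_or eq_sym bx.
  by rewrite inE negb_or eq_sym adj_neq // (avoid y).
have := @tree_no_ucycle (x :: y :: p); rewrite (cons_uniq x) x_notin Up.
rewrite /= xy rcons_path -def_z (adj_sym z) xz andbT.
have -> : path (@adj G) y p by apply: sub_path yp => a b /and3P[].
by case: (p) def_z yz => [/= -> | a q _ _ H]; [rewrite eqxx | have := H isT isT].
Qed.

(** Otherwise [y] and the neighbour of [x] nearer to [r] would coincide by [tree_parent_uniq]. *)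
Lemma tree_dist_neq r x y : adj x y -> dist r x != dist r y.
Proof.
move=> xy; apply/eqP=> dE; have [xr | /(dist_pred Gconn)[z xz rx]] := eqVneq x r.
  move/eqP: dE; rewrite xr distxx eq_sym dist_eq0 // eq_sym -xr => /eqP yx.
  by rewrite yx adj_irr in xy.
have yz := tree_parent_uniq xy xz (eq_leq (esym dE)) (ltnW (eq_leq (esym rx))).
by move: rx; rewrite -yz dE => /n_Sn.
Qed.

(** Joining each vertex other than a root [r] to its parent is a bijection onto the edges: two
    vertices with the same edge would be parents of each other. *)
Lemma tree_card_edges : #|edges G| = #|G|.-1.
Proof.
have /card_gt0P[r _] : 0 < #|G| by case/andP: Gconn.
pose par x := odflt r [pick y | adj x y && (dist r x == (dist r y).+1)].
have parP x : x != r -> adj x (par x) /\ dist r x = (dist r (par x)).+1.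
  rewrite /par; case: pickP => [y /andP[-> /eqP]// | no_y /(dist_pred Gconn)[y xy rx]].
  by have:= no_y y; rewrite xy rx eqxx.
have -> : edges G = [set [set x; par x] | x in [set~ r]].
  apply/setP=> E; rewrite inE; apply/existsP/imsetP; last first.
    case=> x; rewrite !inE => /parP[xpx _] ->.
    by exists x; apply/existsP; exists (par x); rewrite xpx eqxx.
  case=> x /existsP[y /andP[xy /eqP->]].
  wlog rxy : x y xy / dist r y <= dist r x => [IH|].
    case/orP: (leq_total (dist r y) (dist r x)) => le; first exact: IH.
    by rewrite setUC; apply: IH le; rewrite adj_sym.
  have xr : x != r.
    apply: contraTneq rxy => xr; rewrite -ltnNge xr distxx lt0n dist_eq0 // -xr.
    by apply: contraTneq xy => ->; rewrite adj_irr.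
  have [xp rp] := parP x xr; exists x; first by rewrite !inE.
  by rewrite (tree_parent_uniq xy xp rxy) // rp.
rewrite card_in_imset ?cardsC1 // => x y; rewrite !inE => /parP[_ rx] /parP[_ ry] E.
have: x \in [set y; par y] by rewrite -E !inE eqxx.
have: y \in [set x; par x] by rewrite E !inE eqxx.
rewrite !inE => /orP[/eqP// |/eqP yx] /orP[/eqP//|/eqP xy].
by move: rx ry; rewrite -xy -yx; lia.
Qed.

End Tree.

(** * Induced subtrees, and weights at the ends of a cut edge *)

Lemma pendant_unique_adj (G : sgraph) (v x y : G) :
  pendant v -> adj v x -> adj v y -> x = y.
Proof.
by move=> /cards1P[z vE] vx vy; move/setP: vE => vE; move: (vE x) (vE y);
   rewrite !inE vx vy => /esym/eqP-> /esym/eqP->.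
Qed.

Section Induced.
Variable G : sgraph.
Implicit Types (u v w x y : G) (A S : {set G}).

Lemma acyclic_induced A : acyclic G -> acyclic (induced A).
Proof.
move=> Gac; apply/forallP=> k; apply/implyP=> k_gt2; apply/forallP=> c.
apply/negP=> /andP[cyc Uc].
have kG : k < #|G|.+1.
  rewrite ltnS -(size_tuple c) -(size_map val) -(card_uniqP _) ?max_card //.
  by rewrite map_inj_uniq //; apply: val_inj.
have /forallP/(_ (Ordinal kG))/implyP/(_ k_gt2)/forallP := Gac.
move/(_ (map_tuple val c)); rewrite /ucycleb /= map_inj_uniq ?Uc ?andbT; last exact: val_inj.
by case: (tval c) cyc => //= x s; rewrite -map_rcons path_map => ->.
Qed.

(** The retraction [f] of [G] onto [A] may collapse edges, but carries walks of [G] to walks inside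
    [A]. *)
Lemma connected_induced A (f : G -> G) :
    connected G -> {in A, forall x, f x = x} -> (forall x, f x \in A) ->
    (forall x y, adj x y -> f x = f y \/ adj (f x) (f y)) ->
  connected (induced A).
Proof.
move=> Gconn fid fA fadj; pose g x : induced A := Sub (f x) (fA x).
have g_conn x y : connect (@adj (induced A)) (g x) (g y).
  have /connectP[p xp ->] := connectedT Gconn x y.
  elim: p x xp => [|z p IHp] x /=; first by rewrite connect0.
  case/andP=> /fadj fxz /IHp; apply: connect_trans.
  case: fxz => [fxz | ?]; last exact: connect1.
  by have -> : g z = g x by [apply: val_inj]; rewrite connect0.
have gK (x : induced A) : x = g (val x) by apply: val_inj; rewrite /= fid //; apply: valP.
apply/andP; split.
  by have /andP[/card_gt0P[x _] _] := Gconn; apply/card_gt0P; exists (g x).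
by apply/forallP=> x; apply/forallP=> y; rewrite (gK x) (gK y).
Qed.

Lemma card_induced A : #|induced A| = #|A|.
Proof. exact: card_sig. Qed.

(** [S] extends to a branch, a tree with one edge fewer than vertices. *)
Lemma weight_ge v S : subtree_pendant v S -> #|S|.-1 <= weight v.
Proof.
case/maxset_exists=> S' S'max SS'; have /andP[S't _] := maxsetp S'max.
apply: leq_trans (leq_bigmax_cond _ S'max).
by rewrite tree_card_edges // card_induced -!subn1 leq_sub2r // subset_leq_card.
Qed.

Section Cut.
Variables (u w : G) (A : {set G}).
Hypotheses (uw : adj u w) (uA : u \in A) (wA : w \notin A).
Hypothesis cutA : forall x y, x \in A -> y \notin A -> adj x y -> x = u /\ y = w.
Hypothesis Gtree : tree G.

(** Adding [w] to [A] gives a subtree with pendant vertex [w]; it is connected because everything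
    outside [A] can be retracted onto [w]. *)
Lemma weight_cut_ge : #|A| <= weight w.
Proof.
have -> : #|A| = #|w |: A|.-1 by rewrite cardsU1 wA.
apply: weight_ge; apply/andP; split.
  apply/andP; split; last by apply: acyclic_induced; case/andP: Gtree.
  apply: (@connected_induced _ (fun x => if x \in A then x else w)).
  - exact: tree_connected.
  - by move=> x; rewrite !inE => /predU1P[-> | ->] //; rewrite (negPf wA).
  - by move=> x; rewrite !inE; case: ifP => [->|_]; rewrite ?orbT ?eqxx.
  move=> x y xy; case: ifPn => xA; case: ifPn => yA; auto.
    by have [_ <-] := cutA xA yA xy; right.
  by rewrite adj_sym in xy; have [_ <-] := cutA yA xA xy; right; rewrite adj_sym.
have wS : w \in w |: A by rewrite setU11.
have uS : u \in w |: A by rewrite !inE uA orbT.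
apply/existsP; exists (Sub w wS); rewrite eqxx; apply/cards1P; exists (Sub u uS).
apply/setP=> x; rewrite !inE -val_eqE /=.
apply/idP/eqP=> [wx | ->]; last by rewrite adj_sym.
have := valP x; rewrite !inE => /predU1P[xw | xA]; first by rewrite xw adj_irr in wx.
by rewrite adj_sym in wx; have [] := cutA xA wA wx.
Qed.

(** A branch at [u] contains a single neighbour of [u]. If this is [w], the rest of the branch lies
    outside [A]; otherwise the whole branch lies in [A]. *)
Lemma weight_cut_le : weight u <= maxn #|~: A| #|A|.-1.
Proof.
apply/bigmax_leqP=> S /maxsetp /andP[St /existsP[u' /andP[/eqP u'u u'pend]]].
have Sconn := tree_connected St.
have uS : u \in S by rewrite -u'u; apply: valP.
rewrite tree_card_edges // card_induced (cardsD1 u S) uS /= leq_max.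
have closedS (a : pred (induced S)) (x y : induced S) :
    (forall x y : induced S, adj x y -> a x -> a y) -> a x -> a y.
  move=> acl ax; have ->// : a y = a x.
  apply/esym; apply: (@closed_connect _ (@adj (induced S)) a); last exact: connectedT.
  by apply: intro_closed; [apply: connect_adj_sym | apply: acl].
apply/orP; have [wS | wS] := boolP (w \in S); [left | right].
  apply: subset_leq_card; apply/subsetP=> y; rewrite !inE => /andP[yu yS].
  (* Inside the branch this set is closed under adjacency: [A] is left only through [u], whose sole
     neighbour [w] in the branch is outside [A]. By connectedness it would contain [w]. *)
  apply/negP=> yA; pose a := [pred x : induced S | (val x \in A) && (val x != u)].
  suff: a (Sub w wS) by rewrite /= (negPf wA).
  apply: (@closedS a (Sub y yS)) => [b c bc /andP[bA bu]|]; last by rewrite /= yA.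
  apply/andP; split.
    by apply/negPn/negP => cA; have [/eqP] := cutA bA cA bc; rewrite (negPf bu).
  apply: contraNneq wA => cu.
  have cE : c = u' by apply: val_inj; rewrite cu.
  rewrite cE adj_sym in bc; suff bw : b = Sub w wS by move: bA; rewrite bw.
  by apply: (@pendant_unique_adj (induced S) u') => //; rewrite /= u'u.
rewrite (cardsD1 u A) uA; apply: subset_leq_card; apply: setSD.
apply/subsetP=> y yS.
apply: (@closedS [pred x | val x \in A] u' (Sub y yS)) => [b c bc bA|]; last by rewrite /= u'u.
apply/negPn/negP=> cA; have [_ cw] := cutA bA cA bc.
by case/negP: wS; rewrite -cw; apply: valP.
Qed.

End Cut.
End Induced.

(** * The two sides of an edge of a tree, and their levels *)

Section Sides.
Variable G : sgraph.
Implicit Types (r s u v w x y z : G).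
Hypothesis Gtree : tree G.
Let Gconn := tree_connected Gtree.

(** For adjacent [r] and [s] in a tree, this is the component of [s] after removal of the edge
    [rs]. *)
Definition side s r : {set G} := [set x | dist s x < dist r x].

Lemma setC_side r s : adj r s -> ~: side s r = side r s.
Proof.
move=> rs; apply/setP=> x; rewrite !inE -leqNgt leq_eqVlt.
by rewrite !(dist_sym Gconn _ x) (negPf (tree_dist_neq Gtree x rs)).
Qed.

Lemma dist_side r s x : adj r s -> x \in side s r -> dist r x = (dist s x).+1.
Proof.
rewrite inE => rs lt; apply/eqP; rewrite eqn_leq lt andbT !(dist_sym Gconn _ x).
by rewrite dist_adj_step // adj_sym.
Qed.

(** If [x] were not [s], then [y] and the neighbour of [x] towards [s] would both be nearer to [r]
    than [x], hence equal, although [y] is farther from [s] than [x]. *)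
Lemma side_cut r s x y :
  adj r s -> x \in side s r -> y \notin side s r -> adj x y -> x = s /\ y = r.
Proof.
move=> rs xs; rewrite -in_setC setC_side // => yr xy.
have sr : adj s r by rewrite adj_sym.
have rx := dist_side rs xs; have sy := dist_side sr yr.
have := dist_adj_step Gconn r xy; have := dist_adj_step Gconn s xy.
rewrite (adj_sym x) in xy.
have := dist_adj_step Gconn r xy; have := dist_adj_step Gconn s xy.
have := tree_dist_neq Gtree s xy; have := tree_dist_neq Gtree r xy => ? ? ? ? ? ?.
have xy_eq : dist r y = dist s x by lia.
have [xs_eq | ] := eqVneq x s.
  by split=> //; move: xy_eq; rewrite xs_eq distxx => /eqP; rewrite dist_eq0 // => /eqP.
case/(dist_pred Gconn)=> z xz sz; have := dist_adj_step Gconn r xz.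
have zr : dist r z <= (dist s z).+1.
  by rewrite !(dist_sym Gconn _ z) dist_adj_step // adj_sym.
rewrite adj_sym in xy => _; suff yz : y = z by move: sz; rewrite -yz; lia.
by apply: (tree_parent_uniq Gtree (r := r)) xy xz _ _; lia.
Qed.

Lemma dist_across r s x y :
  adj r s -> x \in side s r -> y \in side r s ->
  (dist s x + dist r y).+1 <= dist x y.
Proof.
move=> rs xs yr; have sr : adj s r by rewrite adj_sym.
(* This potential is 0 at [x], rises from [N] to [N.+1] across the edge [sr], and grows by at most
   one along every edge. *)
pose N := dist s x; pose f v := if v \in side s r then N - dist s v else N.+1 + dist r v.
have side_r v : v \notin side s r -> v \in side r s by rewrite -in_setC setC_side.
have fP a b : adj a b -> f b <= (f a).+1.
  move=> ab; rewrite /f; case: ifPn => bs; case: ifPn => as_.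
  - have ba : adj b a by rewrite adj_sym.
    by have := dist_adj_step Gconn s ba; lia.
  - by lia.
  - by have [-> ->] := side_cut rs as_ bs ab; rewrite !distxx; lia.
  by have := dist_adj_step Gconn r ab; lia.
have := dist_lipschitz Gconn fP x y; rewrite /f xs ifN ?subnn; first by lia.
by move: yr; rewrite -setC_side // inE.
Qed.

(* The vertices at depth [i] of the component of [s] once the edge [rs] is removed. *)
Definition side_level r s i : {set G} :=
  [set x | (dist s x == i) && (dist r x == i.+1)].

Definition children r x : {set G} := [set y | adj x y && (dist r y == (dist r x).+1)].

Lemma side_levelS r s i : adj r s ->
  side_level r s i.+1 = \bigcup_(x in side_level r s i) children r x.
Proof.
move=> rs; have le_r v : dist r v <= (dist s v).+1.
  by rewrite !(dist_sym Gconn _ v) dist_adj_step // adj_sym.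
apply/setP=> y; apply/idP/bigcupP=> [|[x]].
  rewrite inE => /andP[/eqP sy /eqP ry].
  have /(dist_pred Gconn)[x yx sx] : y != s by rewrite -(dist_eq0 Gconn) (dist_sym Gconn) sy.
  have := le_r x; rewrite adj_sym in yx; have := dist_adj_step Gconn r yx => ? ?.
  by exists x; rewrite !inE ?yx; apply/andP; split=> //; apply/eqP; lia.
rewrite !inE => /andP[/eqP sx /eqP rx] /andP[xy /eqP ry].
have := le_r y; have := dist_adj_step Gconn s xy; lia.
Qed.

Lemma card_side r s N : adj r s -> {in side s r, forall x, dist s x <= N} ->
  #|side s r| = \sum_(i < N.+1) #|side_level r s i|.
Proof.
move=> rs leN; rewrite -sum1_card (partition_big (fun x => inord (dist s x) : 'I_N.+1) predT) //=.
apply: eq_bigr => i _; rewrite -sum1_card; apply: eq_bigl => x.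
rewrite [RHS]inE; apply/andP/andP=> [[xs /eqP <-] | [/eqP sx /eqP rx]].
  by rewrite (dist_side rs xs) inordK ?eqxx // ltnS leN.
by rewrite inE sx rx ltnS leqnn; split=> //; apply/eqP/val_inj; rewrite /= inordK.
Qed.

Lemma side_level0 r s : adj r s -> side_level r s 0 = [set s].
Proof.
move=> rs; apply/setP=> x; rewrite !inE dist_eq0 // eq_sym.
apply/andP/eqP=> [[/eqP]//|->]; split=> //.
rewrite eqn_leq dist_adj // lt0n dist_eq0 //.
by apply: contraTneq rs => ->; rewrite adj_irr.
Qed.

Hypothesis Gbin : forall v, ~~ pendant v -> deg v = 3.

(** All neighbours of [x] except its parent towards [r] are children, and [x] has degree 1 or 3. *)
Lemma card_children r x : x != r -> #|children r x| = 0 \/ #|children r x| = 2.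
Proof.
case/(dist_pred Gconn)=> y xy rx.
have ->: #|children r x| = (deg x).-1.
  rewrite /deg (cardsD1 y [set u | adj x u]) inE xy /=; apply: eq_card => z; rewrite !inE.
  apply/andP/andP=> [[xz /eqP rz]|[zy xz]]; split=> //.
    by apply/eqP=> zy; move: rx; rewrite -zy rz; lia.
  rewrite eqn_leq dist_adj_step //= ltnNge.
  apply: contra zy => rz; apply/eqP.
  by apply: (tree_parent_uniq Gtree xz xy rz); rewrite rx.
by have [/eqP->|/Gbin->] := boolP (pendant x); [left | right].
Qed.

Lemma side_level_neq r s i x : x \in side_level r s i -> x != r.
Proof.
rewrite inE => /andP[_ /eqP rx].
by rewrite -(dist_eq0 Gconn) (dist_sym Gconn) rx.
Qed.

Lemma card_side_level_le r s i : adj r s -> #|side_level r s i| <= 2 ^ i.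
Proof.
move=> rs; elim: i => [|i IHi]; first by rewrite side_level0 ?cards1.
rewrite side_levelS // expnSr; apply: leq_trans (leq_mul IHi (leqnn 2)).
rewrite -sum_nat_const; elim/big_rec2: _ => [|x A m /side_level_neq xr Am].
  by rewrite cards0.
apply: leq_trans (leq_card_setU _ _) (leq_add _ Am).
by case: (card_children xr) => ->.
Qed.

(** The witness is a deepest vertex of the side; level [i] has at most [2 ^ i] vertices, and a
    geometric sum concludes. *)
Lemma card_side_lt r s : adj r s ->
  exists2 x, x \in side s r & #|side s r| < 2 ^ (dist s x).+1.
Proof.
move=> rs; have ss : s \in side s r.
  by rewrite inE distxx lt0n dist_eq0 //; apply: contraTneq rs => ->; rewrite adj_irr.
case: (@arg_maxnP _ s (mem (side s r)) (dist s) ss) => x xs x_max; exists x => //.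
rewrite (card_side rs x_max).
have: \sum_(i < (dist s x).+1) #|side_level r s i| <= \sum_(i < (dist s x).+1) 2 ^ i.
  by apply: leq_sum => i _; apply: card_side_level_le.
move/leq_ltn_trans; apply.
elim: (dist s x).+1 => [|N IHN]; first by rewrite big_ord0.
by rewrite big_ord_recr /= expnS mul2n -addnn -addSn leq_add2r.
Qed.

(** An ancestor of [y] lies on level [i], and since [i] is positive it comes with a sibling. *)
Lemma card_side_level_ge r s N y i : adj r s -> y \in side_level r s N ->
  0 < i <= N -> 2 <= #|side_level r s i|.
Proof.
move=> rs yN /andP[i0 iN].
have [z zi] : exists z, z \in side_level r s i.
  elim: N y yN iN => [|N IHN] y yN iN; first by lia.
  have [->|neq] := eqVneq i N.+1; first by exists y.
  by move: yN; rewrite side_levelS // => /bigcupP[x xN _]; apply: (IHN x) => //; lia.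
case: i i0 zi {iN} => // i _; rewrite side_levelS // => /bigcupP[x xi zx].
apply: (@leq_trans #|children r x|); last by apply/subset_leq_card/bigcup_sup.
case: (card_children (side_level_neq xi)) => [/eqP|->//].
by rewrite cards_eq0 => /eqP c0; rewrite c0 inE in zx.
Qed.

Lemma card_side_ge r s y : adj r s -> y \in side s r ->
  (2 * dist s y).+1 <= #|side s r|.
Proof.
move=> rs ys; have yl : y \in side_level r s (dist s y).
  by rewrite inE eqxx (dist_side rs ys) eqxx.
have [N dN] : exists N, {in side s r, forall x, dist s x <= N}.
  by exists (\max_x dist s x) => x _; apply: leq_bigmax.
rewrite (card_side rs dN) big_ord_recl side_level0 // cards1 add1n ltnS.
rewrite (eq_bigr (fun i : 'I_N => #|side_level r s i.+1|)) //.
rewrite -(big_mkord predT (fun i => #|side_level r s i.+1|)) (big_cat_nat (n := dist s y)) ?dN //=.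
apply: leq_trans (leq_addr _ _); rewrite mulnC -{1}[dist s y]subn0 -sum_nat_const_nat.
rewrite !big_nat; apply: leq_sum => i /andP[_ iy].
by apply: card_side_level_ge yl _ => //.
Qed.

End Sides.

(** * The upper bound for arbitrary binary trees *)

Lemma leq_dist_setP (G : sgraph) (X Y : {set G}) m :
  reflect (m <= #|G| /\ {in X & Y, forall x y, m <= dist x y}) (m <= dist_set X Y).
Proof.
apply: (iffP (leq_bigminn _ _ _ _)) => -[mG mX]; split=> // x; last first.
  by move=> xX; apply/leq_bigminn; split=> // y; apply: mX.
by move=> y xX; have /leq_bigminn[_] := mX x xX; apply.
Qed.

Lemma exists_closest (G : sgraph) (X Y : {set G}) : X != set0 -> Y != set0 ->
  exists x y, [/\ x \in X, y \in Y, dist_set X Y <= dist x y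
    & {in X & Y, forall x' y', dist x y <= dist x' y'}].
Proof.
case/set0Pn=> x0 x0X /set0Pn[y0 y0Y].
pose P := [pred xy : G * G | (xy.1 \in X) && (xy.2 \in Y)].
have P0 : P (x0, y0) by rewrite /= x0X.
case: (@arg_minnP _ (x0, y0) P (fun xy => dist xy.1 xy.2) P0) => -[x y] /= /andP[xX yY] min.
exists x, y; split=> // [|x' y' x'X y'Y].
  by have /leq_dist_setP[_] := leqnn (dist_set X Y); apply.
by apply: (min (x', y')); rewrite /= x'X.
Qed.

(** The set has the common shape of [center] and [centroid]. *)
Lemma exists_argmin (T : finType) (f : T -> nat) :
  0 < #|T| -> [set v | [forall u, f v <= f u]] != set0.
Proof.
case/card_gt0P=> x _; apply/set0Pn.
case: (@arg_minnP _ x predT f isT) => y _ ymin; exists y.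
by rewrite inE; apply/forallP=> u; apply: ymin.
Qed.

Lemma lt_argmin (T : finType) (f : T -> nat) x y :
  x \in [set v | [forall u, f v <= f u]] -> y \notin [set v | [forall u, f v <= f u]] ->
  f x < f y.
Proof.
rewrite !inE => /forallP xmin /forallPn[u]; rewrite -ltnNge.
exact: leq_ltn_trans.
Qed.

Lemma leq_ecc (G : sgraph) (v u : G) : dist v u <= ecc v.
Proof. exact: leq_bigmax. Qed.

Lemma ecc_attained (G : sgraph) (v : G) : exists u, ecc v = dist v u.
Proof.
have G0 : 0 < #|G| by apply/card_gt0P; exists v.
by have [u uE] := eq_bigmax (dist v) G0; exists u.
Qed.

(** With [w] the centroid vertex closest to the centre and [u] its neighbour towards the centre, [m]
    counts the vertices on the side of [u], and [h] is the height of the side of [w]. *)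
Lemma center_centroid_bound (G : sgraph) (d := center_centroid_dist G) :
    binary_tree G -> 0 < d ->
  exists m h, [/\ 4 * d + 2 * h <= m.+1, 2 * m < #|G| & #|G| - m < 2 ^ h.+1].
Proof.
case/andP=> Gtree /forallP Gbin d_gt0.
have {}Gbin (v : G) : ~~ pendant v -> deg v = 3 by move=> /(implyP (Gbin v))/eqP.
have Gconn := tree_connected Gtree; have /andP[G0 _] := Gconn.
have [z [w [zC wC le_d min_d]]] :=
  exists_closest (exists_argmin (@ecc G) G0) (exists_argmin (@weight G) G0).
have {le_d} d_le : d <= dist z w by [].
have zw : z != w by rewrite -(dist_eq0 Gconn) -lt0n (leq_trans d_gt0).
have [u wu zu] : exists2 u, adj w u & dist z w = (dist z u).+1.
  by apply: dist_pred; rewrite // eq_sym.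
have [p zp wp] : exists2 p, adj z p & dist w z = (dist w p).+1.
  exact: dist_pred.
have uw : adj u w by rewrite adj_sym.
have pz : adj p z by rewrite adj_sym.
have dsym := dist_sym Gconn.
have uCd : u \notin centroid G.
  by apply/negP=> /(min_d z u zC); rewrite zu ltnn.
have pC : p \notin center G.
  by apply/negP=> /min_d/(_ wC); rewrite dsym wp (dsym p) ltnn.
have side_e (r s : G) : adj r s -> s \in side s r.
  by move=> rs; rewrite inE distxx lt0n dist_eq0 //; apply: contraTneq rs => ->; rewrite adj_irr.
have [m mE] : exists m, #|side u w| = m by exists #|side u w|.
have card_B : #|side w u| = #|G| - m by rewrite -(setC_side Gtree wu) -(cardsC (side u w)) mE addKn.
have zA : z \in side u w by rewrite inE -!(dsym z) zu.
(* As [u] is not in the centroid, [m <= weight w < weight u <= maxn (#|G| - m) m.-1], so the maximum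
   is [#|G| - m]. *)
have m_lt : 2 * m < #|G|.
  have := lt_argmin wC uCd.
  have wN : w \notin side u w by rewrite inE distxx.
  have cut := @side_cut _ Gtree w u _ _ wu.
  have := @weight_cut_ge _ u w _ uw (side_e _ _ wu) wN cut Gtree.
  have := @weight_cut_le _ u w _ uw (side_e _ _ wu) wN cut.
  rewrite (setC_side Gtree wu) card_B mE; clear; lia.
have [x xB x_lt] := card_side_lt Gtree Gbin uw.
exists m, (dist w x); rewrite -card_B; split=> //.
have zx : (dist u z + dist w x).+1 <= dist z x.
  by apply: dist_across; rewrite // -?(setC_side Gtree uw) // ?inE.
(* As [p] is not in the centre, [ecc z < ecc p]; hence a vertex [y] farthest from [p] lies beyond
   [z], at distance at least [ecc z] from it. *)
have [y py] := ecc_attained p.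
have := lt_argmin zC pC; rewrite py => ecc_zp.
have zy_lt : dist z y < dist p y by apply: leq_ltn_trans ecc_zp; apply: leq_ecc.
have yz : y \in side z p by rewrite inE.
have wy : (dist p w + dist z y).+1 <= dist w y.
  apply: (dist_across Gtree zp) => //.
  by rewrite inE (dsym z) wp (dsym p).
have uz_y := dist_triangle Gconn u z y.
have zx_ecc := leq_ecc z x.
have py_eq := dist_side Gtree pz yz.
have {zu wp} [zu wp] : dist z w = (dist u z).+1 /\ dist z w = (dist p w).+1.
  by split; [rewrite zu (dsym u) | rewrite dsym wp (dsym p)].
have yA : y \in side u w by rewrite inE; move: zu wy uz_y wp; clear; lia.
have := card_side_ge Gtree Gbin wu yA; rewrite mE.
have := dist_side Gtree wu yA.
move: d_le zx ecc_zp zx_ecc py_eq zu wp wy; clear; lia.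
Qed.

(** * Trees on initial segments of the natural numbers, given by a parent function *)

Section ParentGraph.
Variables (par : nat -> nat) (N : nat).

(** Stated on numbers, so that adjacency becomes an arithmetic condition; the strict inequalities
    exclude loops and make 0 a root. *)
Definition parent_rel (i j : nat) : bool :=
  (i < j) && (par j == i) || (j < i) && (par i == j).

Definition parent_adj : rel 'I_N.+1 := fun i j => parent_rel i j.

Lemma parent_adj_sym : symmetric parent_adj.
Proof. by move=> i j; rewrite /parent_adj /parent_rel orbC. Qed.

Lemma parent_adj_irr : irreflexive parent_adj.
Proof. by move=> i; rewrite /parent_adj /parent_rel ltnn. Qed.

Definition parent_graph : sgraph := SGraph parent_adj_sym parent_adj_irr.

Hypothesis par_lt : forall i, 0 < i -> par i < i.

Lemma parent_relP i : 0 < i -> parent_rel i (par i).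
Proof. by move=> i0; rewrite /parent_rel par_lt // eqxx orbT. Qed.

Lemma parent_rel_le i j : parent_rel i j -> j <= i -> par i = j.
Proof. by case/orP=> /andP[lt /eqP //]; rewrite leqNgt lt. Qed.

Lemma exists_parent (i : 'I_N.+1) : i != ord0 ->
  exists2 j : 'I_N.+1, parent_adj i j & j = par i :> nat.
Proof.
rewrite -lt0n => i0; have jN : par i < N.+1 by apply: ltn_trans (par_lt i0) (ltn_ord i).
by exists (Ordinal jN); first apply: parent_relP.
Qed.

Lemma parent_graph_tree : tree parent_graph.
Proof.
apply/andP; split.
  apply: (@connected_descent parent_graph ord0 (fun i : 'I_N.+1 => i : nat)) => i i0.
  have [j ij jE] := exists_parent i0; exists j => //.
  by rewrite jE par_lt // lt0n.
apply: (@acyclic_rank parent_graph (fun i : 'I_N.+1 => i : nat)) => i j k ij ik ji ki.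
by apply/val_inj; rewrite /= -(parent_rel_le ij ji) (parent_rel_le ik ki).
Qed.

(** Going to parents decreases [depth], and [depth] changes by exactly one along each edge. *)
Lemma parent_graph_dist (depth : nat -> nat) :
    depth 0 = 0 -> (forall i, 0 < i -> depth i = (depth (par i)).+1) ->
  forall i : 'I_N.+1, dist (ord0 : parent_graph) i = depth i.
Proof.
move=> d0 dS i; have Gconn := tree_connected parent_graph_tree.
apply/eqP; rewrite eqn_leq; apply/andP; split.
  apply: (@dist_descent parent_graph (fun j : 'I_N.+1 => depth j)) => j j0.
  have [k jk kE] := exists_parent j0; exists k; first by rewrite adj_sym.
  by rewrite kE [depth j]dS // lt0n.
rewrite -[leqRHS]add0n -d0.
apply: (@dist_lipschitz parent_graph Gconn (fun j : 'I_N.+1 => depth j) _ ord0 i).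
move=> j k /orP[] /andP[lt /eqP E]; first by rewrite [depth k]dS ?E //; lia.
by rewrite [depth j]dS ?E //; lia.
Qed.

Lemma parent_graph_deg (i : 'I_N.+1) :
  deg (i : parent_graph) = (0 < i) + #|[set j : 'I_N.+1 | (i < j) && (par j == i)]|.
Proof.
have [i0|i0] := posnP i.
  by apply: eq_card => j; rewrite !inE /= /parent_adj /parent_rel i0 ltn0 orbF.
have [k ik kE] : exists2 j : 'I_N.+1, parent_adj i j & j = par i :> nat.
  by apply: exists_parent; rewrite -lt0n.
have kI : k < i by rewrite kE par_lt.
rewrite /deg [LHS](cardsD1 k) inE /= ik; congr (_ + _); apply: eq_card => j.
rewrite !inE /= /parent_adj /parent_rel -kE -val_eqE /=; lia.
Qed.

End ParentGraph.

Lemma card_ord_set2 N (a b : nat) (P : pred nat) : a <= N -> b <= N -> a != b ->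
  (forall j, j <= N -> P j = (j == a) || (j == b)) -> #|[set j : 'I_N.+1 | P j]| = 2.
Proof.
move=> aN bN ab PE; have -> : [set j : 'I_N.+1 | P j] = [set inord a; inord b].
  by apply/setP=> j; rewrite !inE PE ?leq_ord // -!val_eqE /= !inordK.
by rewrite cards2 -val_eqE /= !inordK // ab.
Qed.

Lemma card_ord_set1 N (a : nat) (P : pred nat) : a <= N ->
  (forall j, j <= N -> P j = (j == a)) -> #|[set j : 'I_N.+1 | P j]| = 1.
Proof.
move=> aN PE; have -> : [set j : 'I_N.+1 | P j] = [set inord a].
  by apply/setP=> j; rewrite !inE PE ?leq_ord // -!val_eqE /= !inordK.
by rewrite cards1.
Qed.

Lemma card_ord_set0 N (P : pred nat) :
  (forall j, j <= N -> P j = false) -> #|[set j : 'I_N.+1 | P j]| = 0.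
Proof.
by move=> PE; apply: eq_card0 => j; rewrite !inE PE ?leq_ord.
Qed.

(** * The rgood tree as a binary heap *)

Section Heap.
(** The children of [i] are [2i+1] and [2i+2], so level [h] starts at [2^h - 1]. *)
Definition heap_par (i : nat) : nat := i.-1./2.
Definition heap_depth (i : nat) : nat := trunc_log 2 i.+1.
Lemma heap_par_lt i : 0 < i -> heap_par i < i.
Proof. rewrite /heap_par; lia. Qed.

Lemma heap_depth_par i : 0 < i -> heap_depth i = (heap_depth (heap_par i)).+1.
Proof.
move=> i0; rewrite /heap_depth trunc_log2S //; congr (trunc_log 2 _).+1.
rewrite /heap_par; lia.
Qed.

Lemma heap_child_depth (i : nat) : heap_depth (2 * i).+1 = (heap_depth i).+1.
Proof. by rewrite heap_depth_par // /heap_par /= mul2n doubleK. Qed.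

Variable t : nat.

Definition heap : sgraph := parent_graph heap_par (2 * t).

Lemma heap_dist (i : 'I_(2 * t).+1) : dist (ord0 : heap) i = heap_depth i.
Proof. by apply: (@parent_graph_dist _ _ heap_par_lt heap_depth _ heap_depth_par i). Qed.

Lemma heap_deg (i : 'I_(2 * t).+1) : deg (i : heap) = (0 < i) + (i < t).*2.
Proof.
rewrite /heap (@parent_graph_deg _ _ heap_par_lt); congr (_ + _).
pose P j := (i < j) && (heap_par j == i).
have iN := ltn_ord i; case: ltnP => it.
  rewrite (@card_ord_set2 _ (2 * i).+1 (2 * i).+2 P) //; try lia.
  by move=> j jN; rewrite /P /heap_par; apply/idP/idP; lia.
by rewrite (@card_ord_set0 _ P) // /P /heap_par => j; lia.
Qed.

Lemma heap_parentE (x y : heap) : parent (ord0 : heap) x y ->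
  [/\ 0 < (y : 'I__), heap_par (y : 'I__) = (x : 'I__)
    & heap_depth (y : 'I__) = (heap_depth (x : 'I__)).+1].
Proof.
case/andP=> xy; rewrite !heap_dist => /eqP dy.
case/orP: xy => /andP[lt /eqP E]; first by split; rewrite ?E //; lia.
by have := @heap_depth_par x; rewrite E dy; lia.
Qed.

Hypothesis t_gt0 : 0 < t.

(* Heap numbering makes the top-level parents an initial segment of their
   level, so the levels are ordered decreasingly here. *)
Lemma heap_rgood : rgood (ord0 : heap).
Proof.
have hconn := tree_connected (parent_graph_tree (2 * t) heap_par_lt).
split.
- rewrite /rooted_binary_tree parent_graph_tree ?heap_deg; last exact: heap_par_lt.
  rewrite /= t_gt0 orbC eqxx /=; apply/orP; left; apply/forallP=> v; apply/implyP.
  by rewrite heap_deg -lt0n => -> /=; case: (v < t).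
- move=> x y _; rewrite !heap_dist /pendant heap_deg => /eqP y_pend.
  (* For a leaf [y], the number [2y+1] exceeds all vertices, and its depth, one more than that of
     [y], bounds theirs. *)
  have ty : t <= (y : 'I__) by move: y_pend; case: ltnP => //; lia.
  rewrite -heap_child_depth; apply: leq_trunc_log.
  have := ltn_ord (x : 'I__); lia.
exists (fun x y : 'I_(2 * t).+1 => y <= x).
  split=> [h _ | h x y x' y' _ + + px py].
    split=> [x y _ _ | x y _ _ | y x z _ _ _].
    - exact: leq_total.
    - by rewrite -eqn_leq => /eqP/val_inj.
    - by move=> xy yz; apply: leq_trans yz xy.
  have [x0 xE _] := heap_parentE px; have [y0 yE _] := heap_parentE py.
  move=> _ _; rewrite -val_eqE /= -xE -yE /heap_par; lia.
split.
  apply/subsetP=> x; rewrite !inE => /existsP[y /and3P[+ _ /heap_parentE[_ _ dy]]].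
  by rewrite inE !heap_dist dy => /eqP <-.
move=> x z; rewrite !inE => /existsP[y /and3P[+ _ /heap_parentE[y0 yE dy]]].
rewrite inE !heap_dist dy => /eqP top_eq; rewrite -top_eq => /eqP /= dz zx.
(* In the reversed order [z] has a number at most that of [x], which has a child; so [2z+1] is a
   vertex too, and it serves as the top-level leaf below [z]. *)
have zt : (z : 'I__) < t.
  by have := ltn_ord (y : 'I__); move: zx; rewrite -yE /heap_par; lia.
have cN : (2 * (z : 'I__)).+1 < (2 * t).+1 by lia.
apply/existsP; exists (Ordinal cN : heap); rewrite !inE /parent !heap_dist /=.
rewrite !heap_child_depth dz eqxx /= andbT /pendant heap_deg /=; apply/andP; split.
  (* A child of [2z+1] would lie above the top level. *)
  case: ltnP => // ct; have c2N : (2 * (2 * (z : 'I__)).+1).+1 < (2 * t).+1 by lia.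
  have : dist (ord0 : heap) (Ordinal c2N) <= top_level (ord0 : heap) by apply: leq_bigmax.
  by rewrite heap_dist -top_eq /= !heap_child_depth dz ltnn.
by rewrite /parent_adj /parent_rel /heap_par /=; lia.
Qed.

End Heap.

(** * The binary caterpillar *)

Section Caterpillar.
Variable s : nat.

(* The spine is 0, 1, 3, 5, ..., 2s+1; the even vertex 2a > 0 is a leaf attached
   to 2a-1. *)
Definition cat_par (i : nat) : nat := i.-1 - odd i.
Definition cat_leaf (i : nat) : nat := (0 < i) && ~~ odd i.
(** [uphalf i] is the depth of the spine vertex that is [i] itself or carries the leaf [i]. *)
Definition cat_depth (i : nat) : nat := uphalf i + cat_leaf i.
Definition caterpillar : sgraph := parent_graph cat_par (2 * s).+1.

Lemma cat_par_lt i : 0 < i -> cat_par i < i.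
Proof. rewrite /cat_par; lia. Qed.

Lemma cat_depth_par i : 0 < i -> cat_depth i = (cat_depth (cat_par i)).+1.
Proof. rewrite /cat_depth /cat_leaf /cat_par; lia. Qed.

Lemma cat_connected : connected caterpillar.
Proof. exact/tree_connected/parent_graph_tree/cat_par_lt. Qed.

Lemma cat_deg (i : 'I_(2 * s).+2) :
  deg (i : caterpillar) = if odd i && (i < (2 * s).+1) then 3 else 1.
Proof.
rewrite /caterpillar (@parent_graph_deg _ _ cat_par_lt).
have := ltn_ord i; have [i0 _ | i0 iN] := posnP i.
  rewrite i0 /= add0n; pose P j := (0 < j) && (cat_par j == 0).
  by apply: (@card_ord_set1 _ 1 P) => // j; rewrite /P /cat_par; lia.
pose P j := (i < j) && (cat_par j == i); case: ifPn => odd_i.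
  rewrite (@card_ord_set2 _ i.+1 i.+2 P) //; try lia.
  by move=> j; rewrite /P /cat_par; lia.
by rewrite (@card_ord_set0 _ P) // => j; rewrite /P /cat_par; lia.
Qed.

(* The distance from the spine vertex at depth [a] to the vertex [i]. *)
Definition spine_dist (a i : nat) : nat :=
  (a - uphalf i) + (uphalf i - a) + cat_leaf i.

(** One step towards the spine vertex [z]: from a leaf to the spine, or along the spine. It is
    stated on numbers to serve in the caterpillar and in the glued tree. *)
Lemma spine_descent (z i : nat) :
    cat_leaf z = 0 -> i != z -> i < (2 * s).+2 -> z < (2 * s).+2 ->
  exists j, [/\ j < (2 * s).+2, parent_rel cat_par j i
    & spine_dist (uphalf z) j < spine_dist (uphalf z) i].
Proof.
rewrite /cat_leaf /spine_dist /parent_rel /cat_par /cat_leaf => z_sp iz iN zN.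
have [i0|i0] := posnP i; first by exists 1; split; lia.
have [odd_i | even_i] := boolP (odd i); last first.
  by exists i.-1; split; lia.
have [i_lt | i_ge] := ltnP i z; first by exists i.+2; split; lia.
(* For [i = 1] the truncated difference is 0, the correct neighbour. *)
by exists (i - 2); split; lia.
Qed.

Lemma cat_dist_spine (z i : 'I_(2 * s).+2) : cat_leaf z = 0 ->
  dist (z : caterpillar) i <= spine_dist (uphalf z) i.
Proof.
move=> z_sp.
apply: (@dist_descent caterpillar (fun j : 'I_(2 * s).+2 => spine_dist (uphalf z) j)) => {}i iz.
have [j [jN ji lt]] := spine_descent z_sp iz (ltn_ord i) (ltn_ord z).
by exists (Ordinal jN).
Qed.

(** Leaves off the spine hang only at spine depths 1 to [s], which makes up for the extra edges
    leading to them. *)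
Lemma cat_dist_le (i j : caterpillar) : dist i j <= s.+1.
Proof.
have [k kE ik] : exists2 k : 'I_(2 * s).+2, cat_leaf k = 0 /\ uphalf k = uphalf (i : 'I__)
    & dist (i : caterpillar) k <= cat_leaf (i : 'I__).
  have [i_sp | i_leaf] := posnP (cat_leaf (i : 'I__)); first by exists i; rewrite ?distxx.
  have i1 : (i : 'I__).-1 < (2 * s).+2 by have := ltn_ord (i : 'I__); lia.
  exists (Ordinal i1); first by rewrite /=; move: i_leaf; rewrite /cat_leaf; lia.
  apply: (leq_trans (dist_adj _) i_leaf).
  by move: i_leaf; rewrite /= /parent_adj /parent_rel /cat_par /cat_leaf /=; lia.
have := dist_triangle cat_connected i k j; have := cat_dist_spine j kE.1.
rewrite kE.2 /spine_dist; move: ik; rewrite /cat_leaf.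
have := ltn_ord (i : 'I__); have := ltn_ord (j : 'I__); lia.
Qed.

Lemma cat_max_ecc : max_ecc (ord0 : caterpillar).
Proof.
move=> u; apply: (@leq_trans s.+1); first by apply/bigmax_leqP => v _; apply: cat_dist_le.
apply: leq_trans (leq_ecc _ (ord_max : caterpillar)).
rewrite (@parent_graph_dist _ _ cat_par_lt cat_depth) //=; last exact: cat_depth_par.
rewrite /cat_depth /cat_leaf; lia.
Qed.

Lemma cat_binary_caterpillar : binary_caterpillar caterpillar.
Proof.
split.
  rewrite /binary_tree parent_graph_tree /=; last exact: cat_par_lt.
  apply/forallP=> v; apply/implyP; rewrite /pendant cat_deg; by case: ifP.
pose f i : caterpillar := inord (2 * i).+1 : 'I_(2 * s).+2.
have fE i : i < s.+1 -> (f i : 'I__) = (2 * i).+1 :> nat by move=> i_s; rewrite /f inordK; lia.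
have nth_f i : i < s.+1 -> nth ord0 [seq f i | i <- iota 0 s.+1] i = f i.
  by move=> i_s; rewrite (nth_map 0) ?size_iota // nth_iota.
exists ord0, [seq f i | i <- iota 0 s.+1]; split.
- apply/(pathP ord0) => i; rewrite size_map size_iota => i_s.
  rewrite nth_f //= /parent_adj fE //.
  case: i i_s => [_ | i i_s]; first by rewrite /parent_rel /cat_par.
  by rewrite [nth _ _ _]nth_f ?fE /parent_rel /cat_par; lia.
- rewrite cons_uniq; apply/andP; split.
    apply/mapP => -[i]; rewrite mem_iota => /fE fi E.
    by move: fi; rewrite -E.
  rewrite map_inj_in_uniq ?iota_uniq // => i j; rewrite !mem_iota /= => /fE fi /fE fj E.
  by move: fi; rewrite E fj; lia.
have f_mem i : i < s.+1 -> f i \in ord0 :: [seq f i | i <- iota 0 s.+1].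
  by move=> i_s; rewrite inE map_f ?orbT // mem_iota.
move=> v v_notin; have vN := ltn_ord (v : 'I__).
have v0 : 0 < (v : 'I__).
  by rewrite lt0n; apply: contraNneq v_notin => v0; rewrite inE -val_eqE /= v0.
have v_even : ~~ odd (v : 'I__).
  apply: contra v_notin => v_odd; have v_s : (v : 'I__)./2 < s.+1 by lia.
  suff -> : v = f (v : 'I__)./2 by apply: f_mem.
  by apply/val_inj; rewrite /= fE //; lia.
have u_s : (v : 'I__)./2.-1 < s.+1 by lia.
exists (f (v : 'I__)./2.-1); first exact: f_mem.
by rewrite /= /parent_adj fE // /parent_rel /cat_par; lia.
Qed.

End Caterpillar.

(** * The crg tree and the lower bound *)

Section Crg.
Variables (s t : nat).
Hypotheses (t_gt0 : 0 < t) (s_lt : s < t).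

Definition crg : sgraph := glue (ord0 : caterpillar s) (ord0 : heap t).

Definition crg_root : crg := inl ord0.

(** Ranks repeat across the two parts, but a neighbour of no larger rank is still unique: it is the
    parent. *)
Definition crg_rank (v : crg) : nat :=
  match v with inl i => i : 'I__ | inr i => (val i : 'I__) end.

Definition tail_depth (v : crg) : nat :=
  match v with inl i => cat_depth (i : 'I__) | inr _ => 0 end.

Lemma tail_depth_step (u v : crg) : adj u v -> tail_depth v <= (tail_depth u).+1.
Proof.
case: u v => [i|i] [j|j] //=; last by case/andP=> /eqP ->.
case/orP=> /andP[lt /eqP E].
  by rewrite [leqLHS]cat_depth_par ?E //; lia.
by rewrite [cat_depth i]cat_depth_par ?E; lia.
Qed.

(** The last clause records in which part the parent lies; [crg_tail_weight] and [crg_ecc_spine]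
    rely on it. *)
Lemma crg_parent (v : crg) : v != crg_root ->
  exists u, [/\ adj v u, crg_rank u < crg_rank v &
    match v with
    | inl _ => exists i, u = inl i
    | inr i => if heap_par (val i : 'I__) == 0 then u = crg_root
               else exists2 j, u = inr j & (val j : 'I__) = heap_par (val i : 'I__) :> nat
    end].
Proof.
case: v => [i | [i i0]] v0 /=.
  have i0 : i != ord0 by [].
  have [j ij jE] := exists_parent cat_par_lt i0.
  exists (inl j); split=> //; last by exists j.
  by rewrite /= jE cat_par_lt // lt0n.
have [j ij jE] := exists_parent heap_par_lt i0.
have lt_ji : j < i by rewrite jE heap_par_lt // lt0n.
case: eqP => [j0 | /eqP j0].
  exists crg_root; split=> //=; last exact: leq_trans lt_ji.
  have j_0 : j = ord0 by apply/val_inj; rewrite /= jE.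
  by rewrite -j_0 parent_adj_sym.
have jr : j != ord0 by rewrite -val_eqE /= jE.
by exists (inr (Sub j jr)); split=> //; exists (Sub j jr).
Qed.

Lemma tree_crg : tree crg.
Proof.
apply/andP; split.
  apply: (@connected_descent crg crg_root crg_rank) => v /crg_parent[u [vu uv _]].
  by exists u.
apply: (@acyclic_rank crg crg_rank).
have down (u v : crg) : adj u v -> crg_rank v <= crg_rank u ->
    v = match u with
        | inl i => inl (inord (cat_par (i : 'I__)))
        | inr i =>
            if insub (inord (heap_par (val i : 'I__)) : heap t) is Some j
            then inr j else crg_root
        end.
  case: u v => [i|[i i0]] [j|[j j0]] //=.
  - move=> ij ji; congr inl; apply: val_inj.
    by rewrite (parent_rel_le ij ji) /= inordK ?ltn_ord.
  - by case/andP=> /eqP-> _; rewrite leqn0 => /eqP jz; case/eqP: j0; apply/val_inj.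
  - case/andP=> /eqP-> ri _.
    have i_0 : parent_rel heap_par i 0 by rewrite /parent_rel orbC.
    rewrite (parent_rel_le i_0 isT) insubF //; apply/negbTE.
    by rewrite negbK -val_eqE /= inordK.
  move=> ij ji; rewrite (parent_rel_le ij ji).
  have -> : inord j = j :> 'I_(2 * t).+1 by apply: inord_val.
  by rewrite insubT.
by move=> u v w uv uw /(down _ _ uv)-> /(down _ _ uw)->.
Qed.

Lemma crg_card : #|crg| = (2 * s).+2 + 2 * t.
Proof. by rewrite card_sum card_ord card_sig (cardC1 (ord0 : 'I_(2 * t).+1)) card_ord. Qed.

Definition crg_head : {set crg} := [set v | tail_depth v == 0].

Lemma tail_depth_inl (i : 'I_(2 * s).+2) : (tail_depth (inl i) == 0) = (i == ord0).
Proof. rewrite -val_eqE /= /cat_depth /cat_leaf; lia. Qed.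

Lemma crg_card_tail : #|~: crg_head| = (2 * s).+1.
Proof.
have -> : ~: crg_head = [set (inl i : crg) | i in [set~ ord0 : 'I_(2 * s).+2]].
  apply/setP=> v; apply/idP/imsetP=> [|[i]]; rewrite !inE.
    by case: v => [i|//]; rewrite tail_depth_inl => i0; exists i; rewrite // !inE.
  by move=> i0 ->; rewrite tail_depth_inl.
by rewrite card_imset ?cardsC1 ?card_ord // => i j [].
Qed.

Lemma crg_card_head : #|crg_head| = (2 * t).+1.
Proof. by have := cardsC crg_head; rewrite crg_card_tail crg_card; lia. Qed.

(** The edge from the root to vertex 1 of the caterpillar separates a head of [2t+1] vertices from a
    tail of [2s+1], and [s < t]. *)
Lemma crg_root_weight : weight crg_root <= 2 * t.
Proof.
have one_lt : 1 < (2 * s).+2 by [].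
pose w : crg := inl (Ordinal one_lt).
have uw : adj crg_root w by [].
have cut (x y : crg) : x \in crg_head -> y \notin crg_head -> adj x y ->
    x = crg_root /\ y = w.
  rewrite !inE; case: x y => [i|i] [j|j] //; rewrite !tail_depth_inl.
    move=> /eqP-> j0 j_par; split=> //; congr inl; apply/val_inj.
    by move: j_par j0; rewrite -val_eqE /= /parent_adj /parent_rel /cat_par /=; lia.
  by move=> _ j0 /andP[/eqP j_0]; rewrite j_0 in j0.
have uA : crg_root \in crg_head by rewrite inE tail_depth_inl.
have wA : w \notin crg_head by rewrite inE tail_depth_inl.
apply: leq_trans (weight_cut_le uw uA wA cut) _.
by rewrite crg_card_tail crg_card_head geq_max leqnn andbT; lia.
Qed.

(* The witness branch contains the whole heap and the vertices up to [v]. *)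
Lemma crg_tail_weight (v : crg) : 0 < tail_depth v -> 2 * t < weight v.
Proof.
case: v => // i; rewrite lt0n tail_depth_inl => i0.
pose S : {set crg} := [set v | if v is inl j then (j : 'I__) <= i else true].
have iS : inl i \in S by rewrite inE.
have rS : crg_root \in S by rewrite inE.
have [j ij jE] := exists_parent cat_par_lt i0.
have j_lt : j < i by rewrite jE cat_par_lt // lt0n.
have jS : inl j \in S by rewrite inE ltnW.
have /weight_ge le_w : subtree_pendant (inl i : crg) S.
  apply/andP; split; [apply/andP; split|].
  - apply: (@connected_descent (induced S) (Sub crg_root rS) (crg_rank \o val)) => -[v vS].
    rewrite -val_eqE /= => /crg_parent[u [vu uv uE]].
    suff uS : u \in S by exists (Sub u uS).
    move: vS uv uE; rewrite !inE; case: (v) => [k|k] /=.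
      by move=> ki uk [l uE]; move: uk; rewrite uE /= => lk; apply: leq_trans (ltnW lk) ki.
    by case: ifP => [_ _ _ -> | _ _ _ [l ->]].
  - by apply: acyclic_induced; case/andP: tree_crg.
  apply/existsP; exists (Sub (inl i : crg) iS); rewrite eqxx.
  apply/cards1P; exists (Sub (inl j : crg) jS).
  apply/setP=> -[v vS]; rewrite !inE -val_eqE /=.
  apply/idP/eqP=> [|->] //; move: vS; rewrite inE; case: v => [k|k] /=.
    by move=> ki /parent_rel_le/(_ ki) ik; congr inl; apply/val_inj; rewrite /= jE ik.
  by move=> _ /andP[i_0 _]; rewrite i_0 in i0.
apply: leq_trans le_w.
have: (inl i : crg) |: crg_head \subset S.
  apply/subsetP=> v; rewrite !inE => /predU1P[->//|].
  by case: v => [k|//]; rewrite tail_depth_inl => /eqP->.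
move/subset_leq_card; rewrite cardsU1 inE tail_depth_inl i0 crg_card_head; lia.
Qed.

Lemma crg_centroid_head v : v \in centroid crg -> tail_depth v = 0.
Proof.
rewrite inE => /forallP/(_ crg_root) le_root.
have [// | /crg_tail_weight] := posnP (tail_depth v).
by rewrite ltnNge (leq_trans le_root crg_root_weight).
Qed.

(** The tail depth, rounded down, of the midpoint of a path from a deepest heap vertex to the end of
    the tail; 0 if the heap is higher than the tail is long. *)
Definition crg_dist : nat := (s.+1 - heap_depth (2 * t))./2.

(** The witness is the spine vertex at depth [D = crg_dist], whose number is [2D-1]. The far end of
    the tail is at distance [s + 1 - D], and heap vertices are no farther, as [2D + h <= s + 1]. *)
Lemma crg_ecc_spine : 0 < crg_dist ->
  exists z : crg, ecc z <= s.+1 - crg_dist.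
Proof.
rewrite /crg_dist; set h := heap_depth _; set D := _./2 => D0.
have D_le : D.*2 + h <= s.+1 by rewrite /D; lia.
have zN : D.*2.-1 < (2 * s).+2 by lia.
exists (inl (Ordinal zN)).
pose g (v : crg) := match v with
  | inl i => spine_dist D (i : 'I__) | inr i => D + heap_depth (val i : 'I__) end.
have zD : uphalf D.*2.-1 = D by lia.
apply/bigmax_leqP => v _; apply: (@leq_trans (g v)).
  apply: dist_descent => {}v vz; case: v vz => [i|i] v_neq.
    have i_neq : i != D.*2.-1 :> nat by [].
    have z_sp : cat_leaf D.*2.-1 = 0 by rewrite /cat_leaf; lia.
    have [j [jN ji lt]] := spine_descent z_sp i_neq (ltn_ord i) zN.
    by exists (inl (Ordinal jN)) => //; rewrite /= -zD.
  have [u [iu _ uE]] : exists u, _ := @crg_parent (inr i) isT.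
  exists u; first by rewrite adj_sym.
  have i0 : 0 < (val i : 'I__) by rewrite lt0n (valP i).
  rewrite /= [heap_depth _]heap_depth_par //; case: eqP uE => [-> -> | _ [j -> jE]].
    by rewrite /= /spine_dist /cat_leaf /heap_depth /=; lia.
  by rewrite /= jE ltn_add2l.
case: v => [i|i] /=.
  by have := ltn_ord i; rewrite /spine_dist /cat_leaf; lia.
have : heap_depth (val i : 'I__) <= h.
  by rewrite /h /heap_depth leq_trunc_log // ltn_ord.
rewrite /=; lia.
Qed.

(** A vertex nearer to the heap would be too far from the end of the tail, at depth [s + 1], to
    match the eccentricity of [crg_ecc_spine]. *)
Lemma crg_center_tail z : z \in center crg -> crg_dist <= tail_depth z.
Proof.
have [-> //|/crg_ecc_spine[z0 z0_ecc]] := posnP crg_dist.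
rewrite inE => /forallP/(_ z0) zz0.
have end_depth : tail_depth (inl ord_max) = s.+1.
  by rewrite /= /cat_depth /cat_leaf; lia.
have := dist_lipschitz (tree_connected tree_crg) tail_depth_step z (inl ord_max).
have := leq_ecc z (inl ord_max : crg); rewrite end_depth.
have: crg_dist <= s.+1 by rewrite /crg_dist; lia.
move: zz0 z0_ecc; lia.
Qed.

Lemma crg_dist_le : crg_dist <= center_centroid_dist crg.
Proof.
apply/leq_dist_setP; split; first by rewrite crg_card /crg_dist; lia.
move=> z w /crg_center_tail zD /crg_centroid_head w0.
have Gconn := tree_connected tree_crg; rewrite (dist_sym Gconn).
have := dist_lipschitz Gconn tail_depth_step w z; rewrite w0; lia.
Qed.

End Crg.

(** * Comparison of the two bounds *)

Theorem theorem3p1 (n : nat) (hn : 12 <= n) (n_even : ~~ odd n) :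
  exists Tstar : sgraph,
    crg_tree n Tstar /\
    (forall T : sgraph, binary_tree T -> #|T| = n ->
       center_centroid_dist T <= center_centroid_dist Tstar).
Proof.
pose s := (n %/ 4).-1; pose t := n./2 - n %/ 4.
have t_gt0 : 0 < t by rewrite /t; lia.
have s_lt : s < t by rewrite /s /t; lia.
exists (crg s t); split.
  split; [by []|by lia|exists (2 * t).+1; split].
  - by lia.
  - by rewrite /t; lia.
  exists (heap t), ord0, (caterpillar s), ord0; split.
  - by split; [apply: heap_rgood | rewrite card_ord].
  - by split; [apply: cat_binary_caterpillar | rewrite card_ord /s /t; lia].
  - exact: cat_max_ecc.
  by exists id; first by exists id.
move=> T Tbin Tn; have [-> // | d_gt0] := posnP (center_centroid_dist T).
have [m [h [dm m_lt card_lt]]] := center_centroid_bound Tbin d_gt0.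
rewrite Tn in m_lt card_lt; apply: leq_trans (crg_dist_le t_gt0 s_lt).
have h_le : heap_depth (2 * t) <= h.
  (* Otherwise [2^(h+1) <= 2t + 1], so [2^(h+1) <= 2t] by parity. Then [n - m < 2t] gives [m > 2q]
     with [q = n %/ 4], against [2m < n]. *)
  rewrite leqNgt; apply/negP => h_lt.
  have := leq_trans (leq_pexp2l (isT : 0 < 2) h_lt) (trunc_logP (isT : 1 < 2) (ltn0Sn (2 * t))).
  by move: card_lt; rewrite expnS /t; lia.
(* Here [m <= 2q] and [s + 1 = q], so [4d + 2h <= 2q + 1], whence [2d + h <= q] by parity. *)
by move: dm m_lt h_le; rewrite /crg_dist /s; lia.
Qed.
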